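(* Let $\mathtt g$ be a positive integer, let $\mathscr S\subseteq M(\mathbb C)^{\mathtt g}$ be an open free set and let $f:\mathscr S\to M(\mathbb C)$ be a free analytic function. Then $f$ respects intertwinings: if $X\in\mathscr S[n]$, $Y\in\mathscr S[m]$ and $\Gamma$ is an $m\times n$ complex matrix such that $\Gamma X=Y\Gamma$ (that is, $\Gamma X_j=Y_j\Gamma$ for $j=1,\dots,\mathtt g$), then $\Gamma f(X)=f(Y)\Gamma$.
   Context: $M_n(\mathbb C)^{\mathtt g}$ is the set of $\mathtt g$-tuples $X=(X_1,\dots,X_{\mathtt g})$ of $n\times n$ complex matrices. A free set $\mathscr S\subseteq M(\mathbb C)^{\mathtt g}$ is a sequence $\mathscr S=(\mathscr S[n])_{n\ge1}$ with $\mathscr S[n]\subseteq M_n(\mathbb C)^{\mathtt g}$ such that: (i) if $X\in\mathscr S[n]$ and $Y\in\mathscr S[m]$, then $X\oplus Y=(X_1\oplus Y_1,\dots,X_{\mathtt g}\oplus Y_{\mathtt g})\in\mathscr S[n+m]$, where $X_j\oplus Y_j$ is the block diagonal matrix; and (ii) if $X\in\mathscr S[n]$ and $U\in M_n(\mathbb C)$ is unitary, then $U^*XU=(U^*X_1U,\dots,U^*X_{\mathtt g}U)\in\mathscr S[n]$. It is open if each $\mathscr S[n]$ is open in $M_n(\mathbb C)^{\mathtt g}$. For an open free set $\mathscr S$, a free analytic function $f:\mathscr S\to M(\mathbb C)$ is a sequence $f=(f[n])_n$ of analytic functions $f[n]:\mathscr S[n]\to M_n(\mathbb C)$ (each written simply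 $f$) such that (i) $f(X\oplus Y)=f(X)\oplus f(Y)$ for all $X\in\mathscr S[n]$, $Y\in\mathscr S[m]$; and (ii) $f(U^*XU)=U^*f(X)U$ for all $X\in\mathscr S[n]$ and all $n\times n$ unitary matrices $U$. *)

(* Defs.v *)
From HB Require Import structures.
From mathcomp Require Import all_boot all_order all_algebra finmap.
From mathcomp Require Import spectral.
From mathcomp Require Import all_classical all_reals topology normedtype.
From mathcomp Require Import complex.
From mathcomp.analysis.showcase Require summability.

Set Implicit Arguments.
Unset Strict Implicit.
Unset Printing Implicit Defensive.

Import Order.TTheory GRing.Theory Num.Theory.
Import numFieldNormedType.Exports.

Local Open Scope classical_set_scope.
Local Open Scope sesquilinear_scope.
Local Open Scope ring_scope.

(* Declaring the complex numbers at type numClosedFieldType gives them, and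
   matrices over them, the topology of the complex modulus. *)
Definition Cplx (R : realType) : numClosedFieldType := R[i].

(* {ptws _ -> _} is the function type with the product topology. *)
Definition mx_tuple (R : realType) (g n : nat) := {ptws 'I_g -> 'M[Cplx R]_n}.

Definition dsum_mx (R : realType) (n m : nat)
    (A : 'M[Cplx R]_n) (B : 'M[Cplx R]_m) : 'M[Cplx R]_(n + m) :=
  block_mx A 0 0 B.

Definition dsum (R : realType) (g n m : nat)
    (X : mx_tuple R g n) (Y : mx_tuple R g m) : mx_tuple R g (n + m) :=
  fun j => dsum_mx (X j) (Y j).

Definition uconj_mx (R : realType) (n : nat) (U A : 'M[Cplx R]_n) :
    'M[Cplx R]_n :=
  U ^t* *m A *m U.

Definition uconj (R : realType) (g n : nat) (U : 'M[Cplx R]_n)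
    (X : mx_tuple R g n) : mx_tuple R g n :=
  fun j => uconj_mx U (X j).

(* The size n ranges over the positive integers: no condition is imposed on
   S 0. *)
Record free_set (R : realType) (g : nat)
    (S : forall n, set (mx_tuple R g n)) : Prop := FreeSet {
  free_set_dsum : forall n m (X : mx_tuple R g n) (Y : mx_tuple R g m),
    (0 < n)%N -> (0 < m)%N -> S n X -> S m Y -> S (n + m)%N (dsum X Y);
  free_set_uconj : forall n (X : mx_tuple R g n) (U : 'M[Cplx R]_n),
    (0 < n)%N -> S n X -> U \is unitarymx -> S n (uconj U X)
}.

Record open_free_set (R : realType) (g : nat)
    (S : forall n, set (mx_tuple R g n)) : Prop := OpenFreeSet {
  open_free_set_free : free_set S;
  open_free_set_open : forall n, (0 < n)%N -> open (S n)
}.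

(* Exponents of the g * n * n scalar coordinates of a tuple. *)
Definition multi_index (g n : nat) := {ffun 'I_g * 'I_n * 'I_n -> nat}.

Definition monomial (R : realType) (g n : nat) (a : multi_index g n)
    (H : 'I_g -> 'M[Cplx R]_n) : Cplx R :=
  \prod_(p : 'I_g * 'I_n * 'I_n) H p.1.1 p.1.2 p.2 ^+ a p.

(* Near A, f is the sum of a power series in the entries of X - A, with matrix
   coefficients. The finite partial sums converge along the filter of finite
   sets of multi-indices, i.e. the series is absolutely (unconditionally)
   summable. *)
Definition analytic_at (R : realType) (g n : nat)
    (f : mx_tuple R g n -> 'M[Cplx R]_n) (A : mx_tuple R g n) : Prop :=
  exists c : multi_index g n -> 'M[Cplx R]_n,
    \forall X \near A,
      summability.partial_sum
        (fun a => monomial a (fun j => X j - A j) *: c a)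
        @ summability.totally --> f X.

(* f n is a total function whose values outside of S n are irrelevant: when
   S n is open, analyticity at a point of S n only depends on the restriction
   of f n to S n. *)
Record free_analytic (R : realType) (g : nat)
    (S : forall n, set (mx_tuple R g n))
    (f : forall n, mx_tuple R g n -> 'M[Cplx R]_n) : Prop := FreeAnalytic {
  free_analytic_analytic : forall n (X : mx_tuple R g n),
    (0 < n)%N -> S n X -> analytic_at (f n) X;
  free_analytic_dsum : forall n m (X : mx_tuple R g n) (Y : mx_tuple R g m),
    (0 < n)%N -> (0 < m)%N -> S n X -> S m Y ->
    f (n + m)%N (dsum X Y) = dsum_mx (f n X) (f m Y);
  free_analytic_uconj : forall n (X : mx_tuple R g n) (U : 'M[Cplx R]_n),
    (0 < n)%N -> S n X -> U \is unitarymx ->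
    f n (uconj U X) = uconj_mx U (f n X)
}.

(* Main.v *)
(* Let W = X (+) Y and let Z be the block matrix whose only nonzero block is
   Gamma, in the lower left corner; the intertwining relation says that Z
   commutes with W, and the claim is that Z commutes with f(W) = f(X) (+) f(Y).
   Only the complex derivative D of f at W is needed. Differentiating
   f(U^* W U) = U^* f(W) U along unitaries U tangent to a skew-hermitian A gives
   D[W, A] = [f(W), A]. Both sides are complex linear in A, and every matrix is
   S + iT with S and T skew-hermitian, so D[W, Z] = [f(W), Z] for all Z, and
   the left-hand side vanishes for the Z above. *)

Require Import Defs.
From mathcomp Require Import all_boot all_order all_algebra finmap.
From mathcomp Require Import all_classical all_reals topology normedtype.
From mathcomp Require Import spectral ring.
From mathcomp.analysis.showcase Require summability.

Set Implicit Arguments.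
Unset Strict Implicit.
Unset Printing Implicit Defensive.

Import Order.TTheory GRing.Theory Num.Theory.
Import numFieldNormedType.Exports.

Local Open Scope classical_set_scope.
Local Open Scope sesquilinear_scope.
Local Open Scope ring_scope.

(** * Adjoints and skew-hermitian matrices *)

Lemma adjmxM (C : numClosedFieldType) (m n p : nat)
    (A : 'M[C]_(m, n)) (B : 'M[C]_(n, p)) : (A *m B) ^t* = B ^t* *m A ^t*.
Proof. by rewrite trmx_mul map_mxM. Qed.

(** The diagonal entries of [K *m K ^t*] are the sums of squared moduli along the rows of [K]. *)
Lemma mulmx_adj_eq0 (C : numClosedFieldType) (m n : nat) (K : 'M[C]_(m, n)) :
  K *m K ^t* = 0 -> K = 0.
Proof.
move=> KK0; apply/matrixP => i j; rewrite mxE.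
have /matrixP/(_ i i) := KK0; rewrite !mxE => /eqP.
under eq_bigr do rewrite !mxE -normCK.
rewrite psumr_eq0; last by move=> *; rewrite exprn_ge0.
by move=> /allP/(_ j); rewrite mem_index_enum expf_eq0/= normr_eq0 => /(_ isT)/eqP.
Qed.

(** The matrix [K *m K ^t* = K *m A *m K ^t*] is both hermitian and skew-hermitian, hence zero. Thus
    1 is not an eigenvalue of [A]. *)
Lemma skew_fixed_eq0 (C : numClosedFieldType) (n : nat) (A K : 'M[C]_n) :
  A ^t* = - A -> K = K *m A -> K = 0.
Proof.
move=> skA KA; apply: mulmx_adj_eq0.
have E : K *m K ^t* = K *m A *m K ^t* by rewrite -KA.
have : (K *m K ^t*) ^t* = - (K *m K ^t*).
  rewrite {1}E adjmxM adjmxM trmxCK.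
  by rewrite skA mulNmx mulmxN mulmxA -E.
rewrite adjmxM trmxCK => /eqP.
by rewrite -addr_eq0 -mulr2n -scaler_nat scaler_eq0 pnatr_eq0/= => /eqP.
Qed.

Lemma skew_unitmx (C : numClosedFieldType) (n : nat) (A : 'M[C]_n) :
  A ^t* = - A -> 1%:M - A \in unitmx.
Proof.
move=> skA; rewrite -row_free_unit -kermx_eq0; apply/eqP.
apply: (skew_fixed_eq0 skA); apply/eqP.
by rewrite -subr_eq0 -{1}[kermx _]mulmx1 -mulmxBr mulmx_ker.
Qed.

(** * The Cayley transform and its entrywise estimates *)

Lemma unitarymx_entry_le1 (C : numClosedFieldType) (n : nat) (U : 'M[C]_n) i j :
  U \is unitarymx -> `|U i j| <= 1.
Proof.
move=> /unitarymxP/matrixP/(_ i i); rewrite !mxE eqxx mulr1n => E.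
rewrite -(@expr_le1 _ 2)// -E (bigD1 j)//= !mxE -normCK lerDl sumr_ge0// => k _.
by rewrite !mxE -normCK exprn_ge0.
Qed.

(* [P] is the resolvent (1 - A)^-1 and [U = 2 P - 1] the Cayley transform of
   [A]; contractivity of [P] comes from [P = (U + 1) / 2]. *)
Lemma cayley (C : numClosedFieldType) (n : nat) (A : 'M[C]_n) :
  A ^t* = - A ->
  exists P : 'M[C]_n,
    [/\ P = 1%:M + P *m A, P ^t* = 1%:M - A *m P ^t*,
        forall i j, `|P i j| <= 1 &
        exists2 U : 'M[C]_n, U \is unitarymx &
          forall W : 'M[C]_n,
            U ^t* *m W *m U = W + 2 *: (P ^t* *m (W *m A - A *m W) *m P)].
Proof.
move=> skA; have uA := skew_unitmx skA.
set P := invmx (1%:M - A); set Q := P ^t*.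
have PA : P *m A = P - 1%:M.
  by apply/eqP; rewrite eq_sym subr_eq addrC -subr_eq -{1}[P]mulmx1 -mulmxBr mulVmx.
have AP : A *m P = P - 1%:M.
  by apply/eqP; rewrite eq_sym subr_eq addrC -subr_eq -{1}[P]mul1mx -mulmxBl mulmxV.
have AQ : A *m Q = 1%:M - Q.
  have := congr1 (fun M => M ^t*) PA.
  rewrite adjmxM -/Q skA linearB/= map_mxB trmx1 map_mx1 -/Q mulNmx.
  by move=> /(congr1 -%R); rewrite opprK opprB.
have QA : Q *m A = 1%:M - Q.
  have := congr1 (fun M => M ^t*) AP.
  rewrite adjmxM -/Q skA linearB/= map_mxB trmx1 map_mx1 -/Q mulmxN.
  by move=> /(congr1 -%R); rewrite opprK opprB.
(* Evaluating [Q *m A *m P] in two ways gives this identity, from which unitarity of [U] follows. *)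
have QP : 2 *: (Q *m P) = Q + P.
  have : Q *m A *m P = Q *m (A *m P) by rewrite mulmxA.
  rewrite QA AP mulmxBl mulmxBr mul1mx mulmx1 => /eqP.
  by rewrite scaler_nat mulr2n subr_eq addrAC eq_sym subr_eq eq_sym addrC => /eqP->.
pose U := 2 *: P - 1%:M.
have Uct : U ^t* = 2 *: Q - 1%:M.
  by rewrite /U linearB/= linearZ/= map_mxB map_mxZ trmx1 map_mx1 rmorph_nat.
have UP : U ^t* *m P = Q.
  by rewrite Uct mulmxBl -scalemxAl QP mul1mx addrK.
have Uu : U \is unitarymx.
  rewrite -trmxC_unitary; apply/unitarymxP; rewrite trmxCK {2}/U mulmxBr -scalemxAr UP.
  by rewrite Uct mulmx1 opprB addrCA subrr addr0.
exists P; split.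
- by rewrite PA addrC subrK.
- by rewrite -/Q AQ opprB addrC subrK.
- move=> i j.
  have -> : P = 2^-1 *: (U + 1%:M).
    by rewrite subrK scalerA mulVf ?scale1r// pnatr_eq0.
  rewrite !mxE normrM normfV normr_nat ler_pdivrMl ?ltr0n// mulr1.
  rewrite (le_trans (ler_normD _ _))// -[leRHS]/(1 + 1) lerD//.
    by have := unitarymx_entry_le1 i j Uu; rewrite !mxE.
  by case: eqP => _; rewrite ?normr1// normr0.
- exists U => // W.
  have UWU : U ^t* *m U *m W = W.
    by rewrite -trmxC_unitary in Uu; move/unitarymxP: Uu; rewrite trmxCK => ->; rewrite mul1mx.
  (* Resolvent identity: the commutator with an inverse is the commutator with [A], flanked by two
     copies of the inverse. *)
  have WP : W *m P - P *m W = P *m (W *m A - A *m W) *m P.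
    have -> : P *m (W *m A - A *m W) *m P = P *m W *m (A *m P) - P *m A *m W *m P.
      by rewrite mulmxBr mulmxBl !mulmxA.
    rewrite AP PA mulmxBr !mulmxBl mulmx1 mul1mx opprB -!mulmxA.
    by rewrite [RHS]addrC subrKA.
  have WU : W *m U - U *m W = 2 *: (W *m P - P *m W).
    rewrite /U mulmxBr mulmxBl mulmx1 mul1mx opprB addrA subrK.
    by rewrite -scalemxAl -scalemxAr scalerBr.
  apply/eqP; rewrite addrC -subr_eq; apply/eqP.
  (* The difference is [U ^t* *m (W *m U - U *m W)], and [U ^t* *m P = Q] absorbs the left factor of
     the resolvent identity. *)
  rewrite -[X in _ - X]UWU -!mulmxA -mulmxBr WU WP.
  by rewrite -scalemxAr !mulmxA UP.
Qed.

Lemma mulmx_entry_le (C : numDomainType) (m n p : nat) (A : 'M[C]_(m, n))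
    (B : 'M[C]_(n, p)) (a b : C) :
  (forall i j, `|A i j| <= a) -> (forall i j, `|B i j| <= b) ->
  forall i j, `|(A *m B) i j| <= n%:R * (a * b).
Proof.
move=> hA hB i j; rewrite mxE (le_trans (ler_norm_sum _ _ _))//.
rewrite mulr_natl -[X in _ *+ X]card_ord -sumr_const ler_sum// => k _.
by rewrite normrM ler_pM.
Qed.

Lemma entries_bounded (C : numDomainType) (I : finType) (m n : nat)
    (A : I -> 'M[C]_(m, n)) :
  exists2 a, 0 <= a & forall l i j, `|A l i j| <= a.
Proof.
exists (\sum_l \sum_i \sum_j `|A l i j|).
  by do 3 (apply: sumr_ge0 => ? _).
move=> l i j; rewrite (bigD1 l)//= (bigD1 i)//= (bigD1 j)//= -!addrA lerDl.
by rewrite !addr_ge0//; repeat (apply: sumr_ge0 => ? _).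
Qed.

(* [P] is the resolvent of [t *: A]; the constant [c] does not depend on [t]. *)
Lemma cayley_family (C : numClosedFieldType) (n : nat) (A : 'M[C]_n) :
  A ^t* = - A ->
  exists2 c : C, 0 <= c & forall t, 0 <= t ->
    exists P U : 'M[C]_n,
      [/\ U \is unitarymx,
          forall W : 'M[C]_n, U ^t* *m W *m U =
            W + (2 * t) *: (P ^t* *m (W *m A - A *m W) *m P) &
          forall (K : 'M[C]_n) (k : C), (forall i j, `|K i j| <= k) ->
            forall i j, `|(P ^t* *m K *m P) i j| <= c * k /\
              `|(P ^t* *m K *m P - K) i j| <= t * (c * k)].
Proof.
move=> skA; have [a a0 Aa] := entries_bounded (fun _ : unit => A).
have {}Aa := Aa tt.
pose N : C := n%:R; have N0 : 0 <= N by [].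
(* [c1] bounds the two products in [P ^t* *m K *m P]; [c2] bounds the two terms of the difference
   from [K], each with one factor [A]. *)
pose c1 := N * N; pose c2 := a * (N * N * N + N * N).
have c10 : 0 <= c1 by rewrite mulr_ge0.
have c20 : 0 <= c2 by rewrite mulr_ge0// addr_ge0// !mulr_ge0.
exists (c1 + c2) => [|t t0]; first by rewrite addr_ge0.
have sktA : (t *: A) ^t* = - (t *: A).
  by rewrite linearZ/= map_mxZ skA/= geC0_conj// scalerN.
have [P [PE QE P1 [U Uu UW]]] := cayley sktA.
have Q1 i j : `|(P ^t*) i j| <= 1 by rewrite !mxE norm_conjC.
exists P, U; split => // [W|K k Kk i j].
  rewrite UW -scalemxAr -scalemxAl -scalerBr -scalemxAr -scalemxAl scalerA.
  by [].
have k0 : 0 <= k by apply: le_trans (Kk i j).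
set Q := P ^t* in QE Q1 *.
have KP := mulmx_entry_le Kk P1.
have QKP := mulmx_entry_le Q1 KP; rewrite mulmxA in QKP.
split.
  rewrite (le_trans (QKP i j))// mul1r mulr1 mulrA -/N -/c1.
  by rewrite ler_wpM2r// lerDl.
(* Substituting [Q = 1 - t A Q] and then [P = 1 + t P A] exhibits the factor [t]. *)
have -> : Q *m K *m P - K = t *: (K *m P *m A - A *m (Q *m K *m P)).
  rewrite scalerBr; apply/eqP.
  rewrite {1}QE mulmxBl mul1mx mulmxBl {1}PE mulmxDr mulmx1.
  by rewrite -!scalemxAl -!scalemxAr !mulmxA addrAC (addrC K) addrK.
have B1 := mulmx_entry_le KP Aa i j.
have B2 := mulmx_entry_le Aa QKP i j.
rewrite mxE normrM ger0_norm// ler_wpM2l//.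
rewrite (le_trans (y := c2 * k))//; last by rewrite ler_wpM2r// lerDr.
rewrite mxE [X in _ + X]mxE (le_trans (ler_normB _ _))// (le_trans (lerD B1 B2))//.
by rewrite le_eqVlt; apply/orP; left; apply/eqP; rewrite /c2 /N; ring.
Qed.

(** * First-order comparison along unitary conjugates *)

(** One explicit small [t] replaces the limit as [t] tends to 0, so only the order of the field is
    used. *)
Lemma norm_le_small_eq0 (C : numFieldType) (x t0 M : C) :
  0 < t0 -> (forall t, 0 < t -> t <= t0 -> `|x| <= t * M) -> x = 0.
Proof.
move=> t0_gt0 h; apply/eqP/negPn/negP => x0.
have x_gt0 : 0 < `|x| by rewrite normr_gt0.
have M0 : 0 <= M.
  by have := h _ t0_gt0 (lexx _); move=> /(le_trans (normr_ge0 x)); rewrite pmulr_rge0.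
(* [D] exceeds both the modulus of [x] and [t0 * M]. Hence [t0] times that modulus over [D] is a [t]
   below [t0] for which [t * M] is less than the modulus of [x]. *)
set D := `|x| + t0 * (M + 1).
have t0M : 0 < t0 * (M + 1) by rewrite mulr_gt0// ltr_wpDl.
have D0 : 0 < D by rewrite addr_gt0.
have t_gt0 : 0 < t0 * `|x| / D by rewrite divr_gt0// mulr_gt0.
have t_le : t0 * `|x| / D <= t0.
  by rewrite ler_pdivrMr// ler_pM2l// lerDl ltW.
have := h _ t_gt0 t_le.
rewrite mulrAC ler_pdivlMr// mulrAC [_ * `|x|]mulrC ler_pM2l//.
by rewrite /D mulrDr mulr1 addrCA gerDl => /(lt_le_trans (addr_gt0 x_gt0 t0_gt0)); rewrite ltxx.
Qed.

(** Plays the role of the complex derivative of one matrix entry of [f], with [d p] the partial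
    derivative in the scalar coordinate [p]. *)
Definition lin_form (C : pzRingType) (g n : nat) (d : 'I_g * 'I_n * 'I_n -> C)
    (H : 'I_g -> 'M[C]_n) : C := \sum_p d p * H p.1.1 p.1.2 p.2.

Lemma linD (C : pzRingType) (g n : nat) (d : 'I_g * 'I_n * 'I_n -> C)
    (H K : 'I_g -> 'M[C]_n) : lin_form d (fun j => H j + K j) = lin_form d H + lin_form d K.
Proof. by rewrite -big_split; apply: eq_bigr => p _; rewrite mxE mulrDr. Qed.

Lemma linZ (C : comPzRingType) (g n : nat) (d : 'I_g * 'I_n * 'I_n -> C) (a : C)
    (H : 'I_g -> 'M[C]_n) : lin_form d (fun j => a *: H j) = a * lin_form d H.
Proof. by rewrite /lin_form mulr_sumr; apply: eq_bigr => p _; rewrite mxE mulrCA. Qed.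

Lemma lin_norm_le (C : numDomainType) (g n : nat) (d : 'I_g * 'I_n * 'I_n -> C)
    (H : 'I_g -> 'M[C]_n) (s : C) : (forall j i k, `|H j i k| <= s) ->
  `|lin_form d H| <= s * \sum_p `|d p|.
Proof.
move=> hH; rewrite (le_trans (ler_norm_sum _ _ _))// mulr_sumr ler_sum// => p _.
by rewrite normrM mulrC ler_wpM2r.
Qed.

(* Compare the first-order terms in [t] along the curve of Cayley conjugates. *)
Lemma skew_commutator (C : numClosedFieldType) (g n : nat) (W : 'I_g -> 'M[C]_n)
    (fW : 'M[C]_n) (f : ('I_g -> 'M[C]_n) -> 'M[C]_n) (i k : 'I_n)
    (d : 'I_g * 'I_n * 'I_n -> C) (r M : C) (A : 'M[C]_n) :
  (forall U, U \is unitarymx ->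
     f (fun j => U ^t* *m W j *m U) = U ^t* *m fW *m U) ->
  0 < r ->
  (forall (H : 'I_g -> 'M[C]_n) (s : C),
     0 <= s -> s <= r -> (forall j p q, `|H j p q| <= s) ->
     `|f (fun j => W j + H j) i k - fW i k - lin_form d H| <= M * s ^+ 2) ->
  A ^t* = - A ->
  lin_form d (fun j => W j *m A - A *m W j) = (fW *m A - A *m fW) i k.
Proof.
move=> fU r0 fd skA; have [c c0 cP] := cayley_family skA.
pose K j := W j *m A - A *m W j; pose L := fW *m A - A *m fW.
(* The option type indexes all [K j] together with [L], so that a single [b] bounds them. *)
have [b b0 KLb] := entries_bounded (fun o => if o is Some j then K j else L).
have Kb j : forall p q, `|K j p q| <= b := KLb (Some j).
have Lb : forall p q, `|L p q| <= b := KLb None.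
have cb0 : 0 <= c * b by rewrite mulr_ge0.
pose D := \sum_p `|d p|.
apply/esym/eqP; rewrite -subr_eq0 -/L -/K; apply/eqP.
have den0 : 0 < 2 * (c * b) + 1 by rewrite ltr_wpDl// mulr_ge0.
(* The threshold ensures [2 * t * (c * b) <= r], with [+ 1] keeping the denominator positive. The
   three summands come from the quadratic remainder, the change of [L] and the change of the
   [K j]. *)
apply: (@norm_le_small_eq0 _ _ (r / (2 * (c * b) + 1))
  (2 * M * (c * b) ^+ 2 + c * b + c * b * D)) => [|t t0 tr].
  by rewrite divr_gt0.
have [P [U [Uu UW B]]] := cP t (ltW t0).
set Q := P ^t* in UW B.
have t2 : 0 <= 2 * t by rewrite mulr_ge0// ltW.
(* This increment moves [W] exactly to its conjugate by [U], where [f] is known. *)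
have := fd (fun j => (2 * t) *: (Q *m K j *m P)) (2 * t * (c * b)) (mulr_ge0 t2 cb0).
have -> : (fun j => W j + (2 * t) *: (Q *m K j *m P)) =
          (fun j => U ^t* *m W j *m U) by apply/funext => j; rewrite UW.
rewrite fU// UW -/L linZ.
have -> : (fW + (2 * t) *: (Q *m L *m P)) i k - fW i k = 2 * t * (Q *m L *m P) i k.
  by rewrite mxE addrAC subrr add0r mxE.
rewrite -mulrBr.
have HM : forall j p q,
    `|((2 * t) *: (Q *m K j *m P)) p q| <= 2 * t * (c * b).
  move=> j p q; rewrite mxE normrM (ger0_norm t2) ler_wpM2l//.
  by have [] := B (K j) b (Kb j) p q.
have sr : 2 * t * (c * b) <= r.
  rewrite ler_pdivlMr// in tr; apply: le_trans tr.
  by rewrite mulrDr mulr1 [t * (2 * _)]mulrCA [2 * (t * _)]mulrA lerDl ltW.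
move=> /(_ sr HM); rewrite normrM (ger0_norm t2).
have -> : M * (2 * t * (c * b)) ^+ 2 = (2 * t) * (t * (2 * M * (c * b) ^+ 2)) by ring.
rewrite ler_pM2l ?mulr_gt0// => E1.
have [_ E2] := B L b Lb i k.
have E3 : `|lin_form d (fun j => Q *m K j *m P) - lin_form d K| <= t * (c * b * D).
  have -> : lin_form d (fun j => Q *m K j *m P) - lin_form d K =
            lin_form d (fun j => Q *m K j *m P - K j).
    rewrite -mulN1r -linZ -linD; congr lin_form.
    by apply/funext => j; rewrite scaleN1r.
  rewrite mulrA; apply: lin_norm_le => j p q.
  by have [] := B (K j) b (Kb j) p q.
rewrite mxE [X in _ + X]mxE in E2.
set x := L i k in E2 *; set y := lin_form d K in E3 *.
set x' := (_ *m P) i k in E1 E2; set y' := lin_form d _ in E1 E3.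
(* After division by [2 * t], each of the three differences is at most a constant times [t]. *)
have -> : x - y = (x' - y') - (x' - x) + (y' - y) by ring.
rewrite (le_trans (ler_normD _ _))// mulrDr mulrDr; apply: lerD => //.
by rewrite (le_trans (ler_normB _ _))// lerD.
Qed.

(** * From skew-hermitian directions to all matrices *)

Lemma skew_decomposition (C : numClosedFieldType) (n : nat) (Z : 'M[C]_n) :
  exists S T : 'M[C]_n,
    [/\ S ^t* = - S, T ^t* = - T & Z = S + 'i *: T].
Proof.
have i2 : 'i * (2 * 'i)^-1 = 2^-1 :> C.
  by rewrite invfM mulrCA mulfV ?mulr1// neq0Ci.
have c2 : (2^-1 : C) ^* = 2^-1 by rewrite rmorphV ?unitfE ?pnatr_eq0//= rmorph_nat.
have ci : ((2 * 'i)^-1 : C) ^* = - (2 * 'i)^-1.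
  rewrite rmorphV ?unitfE ?mulf_neq0 ?pnatr_eq0 ?neq0Ci//= rmorphM rmorph_nat/=.
  by rewrite conjCi mulrN invrN.
exists (2^-1 *: (Z - Z ^t*)), ((2 * 'i)^-1 *: (Z + Z ^t*)); split.
- by rewrite linearZ/= map_mxZ/= linearB/= map_mxB trmxCK c2 -scalerN opprB.
- by rewrite linearZ/= map_mxZ/= linearD/= map_mxD trmxCK ci scaleNr addrC.
- rewrite scalerA i2 -scalerDr addrCA !addrA subrK -mulr2n -[Z *+ 2]scaler_nat scalerA.
  by rewrite mulVf ?scale1r// pnatr_eq0.
Qed.

(** Both sides are complex linear in the direction, and skew-hermitian matrices span over the
    complex numbers. *)
Lemma commutator_of_skew (C : numClosedFieldType) (g n : nat)
    (W : 'I_g -> 'M[C]_n) (fW : 'M[C]_n) (i k : 'I_n)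
    (d : 'I_g * 'I_n * 'I_n -> C) :
  (forall A : 'M[C]_n, A ^t* = - A ->
     lin_form d (fun j => W j *m A - A *m W j) = (fW *m A - A *m fW) i k) ->
  forall Z : 'M[C]_n,
    lin_form d (fun j => W j *m Z - Z *m W j) = (fW *m Z - Z *m fW) i k.
Proof.
move=> h Z; have [S [T [skS skT ->]]] := skew_decomposition Z.
have comm (V : 'M[C]_n) : V *m (S + 'i *: T) - (S + 'i *: T) *m V =
    (V *m S - S *m V) + 'i *: (V *m T - T *m V).
  rewrite mulmxDr mulmxDl -scalemxAr -scalemxAl scalerBr.
  by rewrite opprD addrACA.
under [fun j => _]eq_fun do rewrite comm.
rewrite comm linD linZ !h//.
by rewrite [RHS]mxE [X in _ = _ + X]mxE.
Qed.

(** * Neighbourhoods in the product topology *)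

(** Entrywise boxes around [A] form a filter base that converges in each coordinate, hence in the
    product topology; so every neighbourhood contains a box. *)
Lemma near_box (R : realType) (g n : nat) (A : mx_tuple R g n) (P : set (mx_tuple R g n)) :
  (\forall X \near A, P X) ->
  exists2 r : Cplx R, 0 < r &
    forall X : mx_tuple R g n, (forall j i k, `|X j i k - A j i k| < r) -> P X.
Proof.
pose F : set_system (mx_tuple R g n) := filter_from [set r : Cplx R | 0 < r]
  (fun r => [set X : mx_tuple R g n | forall j i k, `|X j i k - A j i k| < r]).
have FF : Filter F.
  apply: filter_from_filter; first by exists 1 => /=.
  move=> r s /= r0 s0; exists (Num.min r s) => /=.
    (* The order on [Cplx R] is partial, but positive elements are real and hence comparable. *)
    by rewrite comparable_lt_min ?r0 ?s0//; apply: real_comparable; apply: gtr0_real.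
  have rs : (r >=< s)%O by apply: real_comparable; apply: gtr0_real.
  by move=> X /= h; split=> j i k; have := h j i k; rewrite comparable_lt_min// => /andP[].
suff FA : {ptws, F --> A} by move=> /FA[r r0 rP]; exists r => // X; exact: rP.
apply/cvg_sup => j U [_ [[V oV <-] VA] VU].
have /nbhs_ballP[e /= e0 eV] : nbhs (A j) V by exact: open_nbhs_nbhs.
exists e => //= X h; apply: VU; apply: eV; split=> // i k.
by rewrite /ball/= distrC; exact: h.
Qed.

(** * Absolute bounds from bounds on subset sums *)

(** The nonnegative and the negative terms each give a subset sum whose modulus is the sum of the
    moduli. *)
Lemma sum_norm_real_le (C : numDomainType) (I : eqType) (s : seq I) (x : I -> C) (B : C) :
  (forall a, x a \is Num.real) ->
  (forall P : pred I, `|\sum_(a <- s | P a) x a| <= B) ->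
  \sum_(a <- s) `|x a| <= 2 * B.
Proof.
move=> xr h; rewrite (bigID (fun a => 0 <= x a))/= mulrDl mul1r.
have x0 a : ~~ (0 <= x a) -> x a <= 0.
  by move=> xa; rewrite real_leNgt// ?real0//; apply: contraNN xa => /ltW.
apply: lerD.
  apply: le_trans (h (fun a => 0 <= x a)).
  by rewrite (eq_bigr _ (fun a a0 => ger0_norm a0)) real_ler_norm// rpred_sum.
apply: le_trans (h (fun a => ~~ (0 <= x a))).
rewrite (eq_bigr _ (fun a a0 => ler0_norm (x0 a a0))) sumrN -normrN.
by rewrite real_ler_norm// rpredN rpred_sum.
Qed.

(** Real and imaginary parts of subset sums are again bounded by [B], so each part contributes
    [2 * B]. *)
Lemma sum_norm_le (C : numClosedFieldType) (I : eqType) (s : seq I) (x : I -> C) (B : C) :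
  (forall P : pred I, `|\sum_(a <- s | P a) x a| <= B) ->
  \sum_(a <- s) `|x a| <= 4 * B.
Proof.
move=> h; have -> : 4 * B = 2 * B + 2 * B by ring.
apply: le_trans (_ : \sum_(a <- s) (`|'Re (x a)| + `|'Im (x a)|) <= _).
  apply: ler_sum => a _; rewrite {1}(Crect (x a)) (le_trans (ler_normD _ _))//.
  by rewrite normrM normCi mul1r.
rewrite big_split/= lerD//; apply: sum_norm_real_le => [a|P]; rewrite ?Creal_Re ?Creal_Im//.
  rewrite (le_trans _ (h P))// -raddf_sum/=.
  by have [] := leif_normC_Re_Creal (\sum_(a <- s | P a) x a).
rewrite (le_trans _ (h P))// -raddf_sum/=.
set z := \sum_(_ <- _ | _) _.
(* The imaginary part of [z] is minus the real part of ['i * z], so the bound for real parts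
   applies. *)
have := leif_normC_Re_Creal ('i * z) ; rewrite ReMil normrN normrM normCi mul1r.
by case.
Qed.

Lemma fset_sum_split (V : nmodType) (I : choiceType) (J K : {fset I}) (F : I -> V) :
  (J `<=` K)%fset ->
  \sum_(a <- K) F a = \sum_(a <- J) F a + \sum_(a <- K | a \notin J) F a.
Proof.
move=> JK; rewrite (bigID [in J])/=; congr (_ + _).
apply: eq_fbigl_cond => a; rewrite !inE/= andbT andbC.
by apply: andb_idr; apply: (fsubsetP JK).
Qed.

(* Unconditional Cauchy-ness of complex sums forces absolute boundedness: sums
   over subsets of the complement of [J] are differences of two sums near [l]. *)
Lemma summable_bounded (C : numClosedFieldType) (I : choiceType) (x : I -> C)
    (l : C) (J : {fset I}) :
  (forall K : {fset I}, (J `<=` K)%fset -> `|l - \sum_(a <- K) x a| <= 1) ->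
  exists M, forall K : {fset I}, \sum_(a <- K) `|x a| <= M.
Proof.
(* The 2 bounds a difference of two sums within 1 of [l]; the 4 is the factor from [sum_norm_le]. *)
move=> h; exists (\sum_(a <- J) `|x a| + 4 * 2) => K.
have JJK : (J `<=` J `|` K)%fset by exact: fsubsetUl.
apply: le_trans (_ : \sum_(a <- (J `|` K)%fset) `|x a| <= _).
  by rewrite (fset_sum_split _ (fsubsetUr J K)) lerDl sumr_ge0.
rewrite (fset_sum_split _ JJK) lerD2l -big_filter.
apply: sum_norm_le => P; rewrite big_filter_cond.
pose L := (J `|` [fset a in K | P a])%fset.
have JL : (J `<=` L)%fset by exact: fsubsetUl.
have -> : \sum_(a <- (J `|` K)%fset | (a \notin J) && P a) x a =
    (l - \sum_(a <- J) x a) - (l - \sum_(a <- L) x a).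
  rewrite (fset_sum_split _ JL) [RHS](_ : _ = \sum_(a <- L | a \notin J) x a); last by ring.
  apply: eq_fbigl_cond => a; rewrite !inE/=.
  by case: (a \in J); rewrite ?andbF//= !andbT.
by rewrite (le_trans (ler_normB _ _))// -[2]/(1 + 1) lerD// h.
Qed.

(** * Monomials and first-order expansion of a power series *)

Definition degree (g n : nat) (a : multi_index g n) : nat := \sum_p a p.

Definition unit_index (g n : nat) (p : 'I_g * 'I_n * 'I_n) : multi_index g n :=
  [ffun q => (q == p) : nat].

Lemma unit_index_inj (g n : nat) : injective (@unit_index g n).
Proof.
move=> p q /ffunP/(_ p); rewrite !ffunE eqxx.
by case: eqP.
Qed.

Lemma degree_lt2 (g n : nat) (a : multi_index g n) :
  (degree a < 2)%N -> a = [ffun=> 0%N] \/ exists p, a = unit_index p.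
Proof.
move=> a2; have [/existsP[p ap]|/existsPn a0] := boolP [exists p, (0 < a p)%N].
  right; exists p; apply/ffunP => q; rewrite !ffunE.
  rewrite /degree (bigD1 p)//= in a2.
  have [->|qp] := eqVneq q p; first by move: a2; case: (a p) ap => [//|[|m]].
  move: a2; rewrite (bigD1 q)//=.
  by case: (a p) ap => [//|m] _; case: (a q) => [//|m']; rewrite !addSn addnS.
by left; apply/ffunP => q; rewrite ffunE; apply/eqP; rewrite -leqn0 leqNgt a0.
Qed.

Lemma prod_expr_delta (C : comPzSemiRingType) (I : finType) (F : I -> C) (p : I) :
  \prod_q F q ^+ (q == p) = F p.
Proof. by rewrite (bigD1 p)//= eqxx big1 ?mulr1// => q /negbTE->. Qed.

(** Convertible with [monomial] over [Cplx R]; the general ring lets the estimates be made over an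
    abstract field. *)
Definition mx_monomial (C : comPzRingType) (g n : nat) (a : multi_index g n)
    (H : 'I_g -> 'M[C]_n) : C :=
  \prod_(p : 'I_g * 'I_n * 'I_n) H p.1.1 p.1.2 p.2 ^+ a p.

Lemma mx_monomial0 (C : comPzRingType) (g n : nat) (H : 'I_g -> 'M[C]_n) :
  mx_monomial [ffun=> 0%N] H = 1.
Proof. by rewrite /mx_monomial big1// => p _; rewrite ffunE. Qed.

Lemma mx_monomial_unit (C : comPzRingType) (g n : nat) (p : 'I_g * 'I_n * 'I_n)
    (H : 'I_g -> 'M[C]_n) :
  mx_monomial (unit_index p) H = H p.1.1 p.1.2 p.2.
Proof.
rewrite -[RHS](prod_expr_delta (fun q => H q.1.1 q.1.2 q.2)).
by apply: eq_bigr => q _; rewrite ffunE.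
Qed.

Lemma mx_monomial_const (C : comPzRingType) (g n : nat) (a : multi_index g n) (r : C) :
  mx_monomial a (fun=> const_mx r) = r ^+ degree a.
Proof. by rewrite -prodrXr; apply: eq_bigr => p _; rewrite mxE. Qed.

Lemma mx_monomial_norm_le (C : numDomainType) (g n : nat) (a : multi_index g n)
    (H : 'I_g -> 'M[C]_n) (s : C) :
  (forall j i k, `|H j i k| <= s) -> `|mx_monomial a H| <= s ^+ degree a.
Proof.
move=> Hs; rewrite -prodrXr normr_prod; apply: ler_prod => p _.
rewrite normr_ge0 normrX/= lerXn2r ?nnegrE//.
exact: le_trans (Hs p.1.1 p.1.2 p.2).
Qed.

(** Terms of degree at most 1 form the affine part. The remaining ones are compared with the series
    at the constant tuple [r], whose sums of moduli are bounded. *)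
Lemma first_order_of_summable (C : numClosedFieldType) (g n : nat)
    (c : multi_index g n -> C) (F : ('I_g -> 'M[C]_n) -> C) (r0 : C) :
  0 < r0 ->
  (forall H : 'I_g -> 'M[C]_n, (forall j p q, `|H j p q| < r0) ->
    forall e, 0 < e ->
    exists J : {fset multi_index g n}, forall K, (J `<=` K)%fset ->
      `|F H - \sum_(a <- K) mx_monomial a H * c a| < e) ->
  exists (d : 'I_g * 'I_n * 'I_n -> C) (r M : C), 0 < r /\
    forall (H : 'I_g -> 'M[C]_n) (s : C), 0 <= s -> s <= r ->
      (forall j p q, `|H j p q| <= s) ->
      `|F H - F (fun=> 0) - lin_form d H| <= M * s ^+ 2.
Proof.
move=> r00 approx; pose x (H : 'I_g -> 'M[C]_n) a := mx_monomial a H * c a.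
(* Halving puts the constant tuple [r] strictly inside the box of convergence. *)
pose r := r0 / 2; have r_gt0 : 0 < r by rewrite divr_gt0.
have rr0 : r < r0 by rewrite ltr_pdivrMr// mulr_natr mulr2n ltrDl.
have [|J1 J1P] := approx (fun=> const_mx r) _ 1 ltr01.
  by move=> j p q; rewrite mxE gtr0_norm.
have [M MP] := summable_bounded (fun K JK => ltW (J1P K JK)).
(* [E1] collects the indices of degree 1, and [J0] those of degree at most 1. *)
pose E1 := [fset unit_index p | p in {: 'I_g * 'I_n * 'I_n}]%fset.
pose J0 := ([ffun=> 0%N] |` E1)%fset.
pose d p := c (unit_index p).
have J0sum H : \sum_(a <- J0) x H a = c [ffun=> 0%N] + lin_form d H.
  have -> : \sum_(a <- J0) x H a = x H [ffun=> 0%N] + \sum_(a <- E1) x H a.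
    apply: big_fsetU1.
    by apply/imfsetP => -[p _ /ffunP/(_ p)]; rewrite !ffunE eqxx.
  rewrite {1}/x mx_monomial0 mul1r big_imfset/=; last first.
    by move=> p q _ _; exact: unit_index_inj.
  congr (_ + _); rewrite /lin_form big_enum/=; apply: eq_bigr => p _.
  by rewrite /x mx_monomial_unit mulrC.
have J0deg a : a \notin J0 -> (2 <= degree a)%N.
  rewrite leqNgt; apply: contraNN => /degree_lt2[->|[p ->]]; rewrite !inE ?eqxx//.
  by rewrite in_imfset ?orbT.
have est (H : 'I_g -> 'M[C]_n) (s : C) : 0 <= s -> s <= r ->
    (forall j p q, `|H j p q| <= s) ->
    `|F H - (c [ffun=> 0%N] + lin_form d H)| <=
      M / r ^+ 2 * s ^+ 2.
  (* A finite partial sum containing [J0] approximates [F H] within [e]; its tail [T] is bounded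
     independently of [e]. *)
  move=> s0 sr Hs; apply/ler_addgt0Pr => e e0.
  have [|J JP] := approx H _ e e0.
    by move=> j p q; rewrite (le_lt_trans (Hs _ _ _))// (le_lt_trans sr).
  have /JP := fsubsetUl J J0; rewrite (fset_sum_split _ (fsubsetUr J J0)) J0sum.
  set K := (J `|` J0)%fset; set T := \sum_(a <- K | _) _.
  (* Terms of degree at least 2 shrink by a factor (s / r)^2 when the entries
     pass from r to s. *)
  have T_le : `|T| <= M / r ^+ 2 * s ^+ 2.
    rewrite mulrAC ler_pdivlMr ?exprn_gt0// mulrC.
    apply: le_trans (_ : s ^+ 2 * \sum_(a <- K | a \notin J0) `|x (fun=> const_mx r) a| <= _).
      apply: le_trans (_ : r ^+ 2 * \sum_(a <- K | a \notin J0) `|x H a| <= _).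
        by rewrite ler_wpM2l ?exprn_ge0 ?(ltW r_gt0)//; exact: ler_norm_sum.
      rewrite !mulr_sumr.
      apply: ler_sum => a /J0deg a2; rewrite /x !normrM mulrA mulrA ler_wpM2r//.
      rewrite mx_monomial_const [X in _ <= _ * X]ger0_norm ?exprn_ge0 ?(ltW r_gt0)//.
      apply: le_trans (_ : r ^+ 2 * s ^+ degree a <= _).
        by rewrite ler_wpM2l ?exprn_ge0 ?(ltW r_gt0)//; exact: mx_monomial_norm_le.
      rewrite -(subnKC a2) !exprD [leRHS]mulrCA.
      rewrite ler_wpM2l ?exprn_ge0 ?(ltW r_gt0)// ler_wpM2l ?exprn_ge0//.
      by rewrite lerXn2r ?nnegrE// ltW.
    rewrite [leRHS]mulrC ler_wpM2l ?exprn_ge0//.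
    by apply: le_trans (MP K); rewrite [leRHS](bigID (fun a => a \notin J0))/= lerDl sumr_ge0.
  set c0 := c _ + _ => hT.
  have -> : F H - c0 = T + (F H - (c0 + T)) by ring.
  by rewrite (le_trans (ler_normD _ _))// lerD// ltW.
exists d, r, (M / r ^+ 2); split=> // H s s0 sr Hs.
(* The estimate at [H = 0] with [s = 0] identifies the constant term. *)
suff -> : F (fun=> 0) = c [ffun=> 0%N] by rewrite -addrA -opprD; exact: est.
have := est (fun=> 0) 0 (lexx _) (ltW r_gt0).
rewrite expr0n mulr0 normr_le0 subr_eq0 => /(_ _)/eqP ->.
  by rewrite /lin_form big1 ?addr0// => p _; rewrite mxE mulr0.
by move=> j p q; rewrite mxE normr0.
Qed.

Lemma partial_sum_mxE (V : zmodType) (I : choiceType) (m n : nat)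
    (u : I -> 'M[V]_(m, n)) (K : {fset I}) i k :
  summability.partial_sum u K i k = \sum_(a <- K) u a i k.
Proof. by rewrite big_seq_fsetE /summability.partial_sum summxE. Qed.

(** Convergence in the matrix norm gives convergence of the entry at [i], [k], which reduces the
    claim to a scalar series. *)
Lemma first_order (R : realType) (g n : nat) (f : mx_tuple R g n -> 'M[Cplx R]_n)
    (A : mx_tuple R g n) (i k : 'I_n) :
  analytic_at f A ->
  exists (d : 'I_g * 'I_n * 'I_n -> Cplx R) (r M : Cplx R), 0 < r /\
    forall (H : 'I_g -> 'M[Cplx R]_n) (s : Cplx R), 0 <= s -> s <= r ->
      (forall j p q, `|H j p q| <= s) ->
      `|f (fun j => A j + H j) i k - f A i k - lin_form d H| <= M * s ^+ 2.
Proof.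
case=> c /near_box[r0 r00 cvg_f].
have /(first_order_of_summable r00)[d [r [M [r_gt0 hd]]]] : forall H : 'I_g -> 'M[Cplx R]_n,
    (forall j p q, `|H j p q| < r0) -> forall e, 0 < e ->
    exists J : {fset multi_index g n}, forall K, (J `<=` K)%fset ->
      `|f (fun j => A j + H j) i k - \sum_(a <- K) mx_monomial a H * c a i k| < e.
  move=> H Hr e e0.
  have cvA : summability.partial_sum
      (fun a => monomial a (fun j => A j + H j - A j) *: c a)
      @ summability.totally --> f (fun j => A j + H j).
    by apply: cvg_f => j p q; rewrite mxE addrAC subrr add0r.
  have [J _ JP] := cvA _ (nbhsx_ballx _ e e0); exists J => K JK.
  have [_ /(_ i k) JPik] := JP K JK.
  pose u a := monomial a (fun j => A j + H j - A j) *: c a.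
  have : `|f (fun j => A j + H j) i k - summability.partial_sum u K i k| < e.
    exact: JPik.
  rewrite partial_sum_mxE.
  congr (`|_ - _| < _); apply: eq_bigr => a _; rewrite /u mxE; congr (_ * _).
  by congr mx_monomial; apply/funext => j; rewrite addrAC subrr add0r.
exists d, r, M; split=> // H s s0 sr Hs.
rewrite (_ : f A = f (fun j => A j + 0)); first exact: hd.
by congr f; apply/funext => j; rewrite addr0.
Qed.

(** * Intertwinings as vanishing commutators *)

Theorem proposition1p2 (R : realType) (g : nat) (hg : (0 < g)%N)
    (S : forall n : nat, set (mx_tuple R g n))
    (f : forall n : nat, mx_tuple R g n -> 'M[Cplx R]_n)
    (hS : open_free_set S) (hf : free_analytic S f)
    (n m : nat) (hn : (0 < n)%N) (hm : (0 < m)%N)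
    (X : mx_tuple R g n) (Y : mx_tuple R g m) (Gamma : 'M[Cplx R]_(m, n))
    (hX : S n X) (hY : S m Y)
    (hGamma : forall j : 'I_g, Gamma *m X j = Y j *m Gamma) :
  Gamma *m f n X = f m Y *m Gamma.
Proof.
pose W : mx_tuple R g (n + m) := dsum X Y.
have SW : S (n + m)%N W := free_set_dsum (open_free_set_free hS) hn hm hX hY.
have nm0 : (0 < n + m)%N by rewrite addn_gt0 hn.
pose Z : 'M[Cplx R]_(n + m) := block_mx 0 0 Gamma 0.
have comm (A : 'M[Cplx R]_n) (B : 'M[Cplx R]_m) :
    dsum_mx A B *m Z - Z *m dsum_mx A B = block_mx 0 0 (B *m Gamma - Gamma *m A) 0.
  rewrite /dsum_mx /Z !mulmx_block opp_block_mx add_block_mx.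
  by rewrite !(mul0mx, mulmx0, addr0, add0r, subrr, oppr0).
have comm_fW : f (n + m)%N W *m Z - Z *m f (n + m)%N W = 0.
  apply/matrixP => i k.
  have [d [r [M [r_gt0 hd]]]] :=
    first_order i k (free_analytic_analytic hf nm0 SW).
  have skew := skew_commutator (fun U => free_analytic_uconj hf nm0 SW) r_gt0 hd.
  (* Each commutator of [W j] with [Z] vanishes by the intertwining relation, so the derivative is
     evaluated at zero. *)
  rewrite -(commutator_of_skew skew) [RHS]mxE /lin_form big1// => p _.
  by rewrite comm hGamma subrr block_mx0 mxE mulr0.
(* The lower left block of the vanishing commutator is [f m Y *m Gamma - Gamma *m f n X]. *)
move: comm_fW; rewrite (free_analytic_dsum hf hn hm hX hY) comm -block_mx0.
by move=> /eq_block_mx[_ _ /eqP + _]; rewrite subr_eq0 => /eqP.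
Qed.
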